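(* Let $\mathcal{A}$ be a transition-based automaton over infinite words, with finite set of states $Q$, set of transitions $\Delta\subseteq Q\times\Sigma\times Q$, set of initial states $Q_{\mathsf{init}}\subseteq Q$ and acceptance condition $\mathit{Acc}\subseteq\Delta^\omega$. Then there is a state-based automaton equivalent to $\mathcal{A}$ with at most $|Q|\,|\Delta|+|Q_{\mathsf{init}}|$ states.
   Context: An automaton over an alphabet $\Sigma$ consists of a finite set of states $Q$, a set of transitions $\Delta\subseteq Q\times\Sigma\times Q$, a set of initial states $Q_{\mathsf{init}}\subseteq Q$ and an acceptance condition. A run over an infinite word $w=a_1a_2\cdots\in\Sigma^\omega$ is an infinite path $(q_0,a_1,q_1)(q_1,a_2,q_2)\cdots$ of transitions in $\Delta$ with $q_0\in Q_{\mathsf{init}}$. A state-based acceptance condition is a language $\mathit{Acc}\subseteq Q^\omega$; a run $(q_0,a_1,q_1)(q_1,a_2,q_2)\cdots$ is accepting if $q_0q_1q_2\cdots\in\mathit{Acc}$. A transition-based acceptance condition is a language $\mathit{Acc}\subseteq\Delta^\omega$; a run is accepting if its sequence of transitions belongs to $\mathit{Acc}$. Such conditions may also be represented via a finite set of colours $C$, a colouring $\gamma$ of states (resp. transitions) by $C$ and a language $\mathit{Acc}'\subseteq C^\omega$: a run is then accepting iff the colour sequence of its states (resp. transitions) is in $\mathit{Acc}'$. An automaton is called state-based or transition-based according to the kind of its acceptance condition. The automaton accepts a word if some run over it is accepting. Two automata are equivalent if they accept the same words of $\Sigma^\omega$. *)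

(* Defs.v *)
From HB Require Import structures.
From mathcomp Require Import all_boot.
Set Implicit Arguments.
Unset Strict Implicit.
Unset Printing Implicit Defensive.

Definition omega_word (A : Type) : Type := nat -> A.
Definition omega_lang (A : Type) : Type := omega_word A -> Prop.

(* Automaton without its acceptance condition; nondeterministic and possibly
   incomplete. *)
Record automaton (Sigma : finType) := Automaton {
  state : finType;
  Delta : {set state * Sigma * state};
  Qinit : {set state}
}.

(* Delta as a type, so that languages over it are subsets of Delta^omega. *)
Definition transition (Sigma : finType) (A : automaton Sigma) : Type :=
  {t : state A * Sigma * state A | t \in Delta A}.

Section Runs.
Variables (Sigma : finType) (A : automaton Sigma).

Definition source (t : transition A) : state A := (sval t).1.1.
Definition label (t : transition A) : Sigma := (sval t).1.2.
Definition target (t : transition A) : state A := (sval t).2.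

(* Indices start at 0: [rho i] is (q_i, a_(i+1), q_(i+1)) and [w i] is
   a_(i+1). *)
Definition is_run (w : omega_word Sigma) (rho : omega_word (transition A)) :
    Prop :=
  [/\ source (rho 0) \in Qinit A,
      forall i, label (rho i) = w i
    & forall i, target (rho i) = source (rho i.+1)].

Definition run_states (rho : omega_word (transition A)) : omega_word (state A) :=
  fun i => source (rho i).

End Runs.

Record transition_based (Sigma : finType) := TransitionBased {
  tb_automaton :> automaton Sigma;
  tb_Acc : omega_lang (transition tb_automaton)
}.

Record state_based (Sigma : finType) := StateBased {
  sb_automaton :> automaton Sigma;
  sb_Acc : omega_lang (state sb_automaton)
}.

Definition tb_accepts (Sigma : finType) (A : transition_based Sigma) :
    omega_lang Sigma :=
  fun w => exists rho : omega_word (transition A), is_run w rho /\ tb_Acc rho.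

Definition sb_accepts (Sigma : finType) (B : state_based Sigma) :
    omega_lang Sigma :=
  fun w => exists rho : omega_word (transition B),
    is_run w rho /\ sb_Acc (run_states rho).

Definition same_lang (A : Type) (L1 L2 : omega_lang A) : Prop :=
  forall w, L1 w <-> L2 w.

(* Main.v *)
(** The states of the state-based automaton are the transitions of [A]: being
    in state [t] means that [t] is the transition that [A] takes next. A run of
    the new automaton then visits exactly the transitions of a run of [A], so
    the acceptance condition carries over unchanged, and [#|Delta A|] states
    suffice. *)

Require Import Defs.
From mathcomp Require Import all_boot.

Definition lookahead {Sigma : finType} (A : automaton Sigma) :
    automaton Sigma :=
  @Automaton Sigma {t : state A * Sigma * state A | t \in Delta A}
    [set u | (label u.1.1 == u.1.2) && (target u.1.1 == source u.2)]
    [set t | source t \in Qinit A].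

(** The edge condition of [lookahead] is exactly what [is_run] asks of two consecutive transitions
    of [A]. *)
Lemma lookahead_run_states {Sigma : finType} {A : automaton Sigma}
    {w : omega_word Sigma} (sigma : omega_word (transition (lookahead A))) :
  is_run w sigma -> is_run w (run_states sigma : omega_word (transition A)).
Proof.
case=> init_sigma label_sigma target_sigma.
have step i : label (source (sigma i)) = label (sigma i) /\
              target (source (sigma i)) = source (target (sigma i)).
  by move: (svalP (sigma i)); rewrite inE => /andP[/eqP ? /eqP ?].
split=> [|i|i].
- by rewrite inE in init_sigma.
- by rewrite /run_states (step i).1.
- by rewrite /run_states (step i).2 target_sigma.
Qed.

Lemma lookahead_run_lift {Sigma : finType} {A : automaton Sigma}
    {w : omega_word Sigma} {rho : omega_word (transition A)} :
  is_run w rho ->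
  exists2 sigma : omega_word (transition (lookahead A)),
    is_run w sigma & run_states sigma = rho.
Proof.
case=> init_rho label_rho target_rho.
have step i : (rho i, w i, rho i.+1) \in Delta (lookahead A).
  by rewrite inE /= label_rho target_rho !eqxx.
(* The source of the [i]-th triple computes to [rho i], so [run_states sigma = rho] holds by
   conversion. *)
exists (fun i => Sub (_, _, _) (step i)) => //.
by split=> //; rewrite inE.
Qed.

Theorem proposition2 (Sigma : finType) (A : transition_based Sigma) :
  exists B : state_based Sigma,
    same_lang (sb_accepts B) (tb_accepts A) /\
    #|state B| <= #|state A| * #|Delta A| + #|Qinit A|.
Proof.
exists (@StateBased Sigma (lookahead A) (@tb_Acc Sigma A)); split.
- move=> w; split=> [[sigma [run_sigma acc_sigma]]|[rho [run_rho acc_rho]]].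
    by exists (run_states sigma); split=> //; apply: lookahead_run_states.
  have [sigma run_sigma sigmaK] := lookahead_run_lift run_rho.
  by exists sigma; split; rewrite // sigmaK.
- rewrite /= card_sig.
  (* [state A] may be empty, but then so is [Delta A]; otherwise the source [q] of a transition
     gives the factor [#|state A| >= 1]. *)
  case: (set_0Vmem (Delta A)) => [-> | [[[q a] q'] _]].
    by rewrite (eq_card0 (in_set0 (T := _))).
  apply: leq_trans (leq_addr _ _); apply: leq_pmull.
  by apply/card_gt0P; exists q.
Qed.
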